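(* For all $\nu\in\mathcal V$ and $n,m\in\mathbb{N}$ we have $$G_m^{(\nu+n)}\bigl(G_{n+m}^{(\nu)}\bigr)^{-1}P_{m+n}^{(\nu)}(x)=\sum_{k=0}^{\min(n,m)}\binom{n}{k}\binom{m}{k}k!\,P_{m-k}^{(\nu+n+k)}(x)\bigl(G_{n-k}^{(\nu+k)}\bigr)^{-1}P_{n-k}^{(\nu+k)}(x)\left(\Phi^{(\nu)}(x)\cdots\Phi^{(\nu+k-1)}(x)\right)^\ast .$$
   Context: General setting. $\mathcal V$ is a parameter set such that $\nu\in\mathcal V$ implies $\nu+1\in\mathcal V$. For each $\nu\in\mathcal V$, $W^{(\nu)}$ is an $N\times N$ matrix weight on an interval $[a,b]$ ($a,b$ possibly infinite): $W^{(\nu)}$ is Hermitian, positive definite almost everywhere, at least $C^2$ on $(a,b)$, and has finite moments of all orders. $^\ast$ is the conjugate transpose. $\{P_n^{(\nu)}\}_{n\ge0}$ are the monic matrix valued orthogonal polynomials (leading coefficient the identity) for $W^{(\nu)}$, i.e. $\int_a^bP_n^{(\nu)}(x)W^{(\nu)}(x)P_m^{(\nu)}(x)^\ast dx=0$ for $n\neq m$. Assumptions, for all $\nu\in\mathcal V$: (1) (Pearson equations) there are matrix valued polynomials $\Phi^{(\nu)}$, $\Psi^{(\nu)}$ of degree at most two and one respectively with $W^{(\nu+1)}(x)=W^{(\nu)}(x)\Phi^{(\nu)}(x)$ and $\frac{dW^{(\nu+1)}}{dx}(x)=W^{(\nu)}(x)\Psi^{(\nu)}(x)$ for all $x$; (2)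 (shift operators) with the operator $S^{(\nu)}$ acting from the right by $(QS^{(\nu)})(x)=\frac{dQ}{dx}(x)\Phi^{(\nu)}(x)^\ast+Q(x)\Psi^{(\nu)}(x)^\ast$, one has, for $n\ge1$, $\frac{dP_n^{(\nu)}}{dx}=nP_{n-1}^{(\nu+1)}$ and $P_{n-1}^{(\nu+1)}S^{(\nu)}=K_n^{(\nu)}P_n^{(\nu)}$ with $K_n^{(\nu)}$ a constant invertible matrix; (3) (Rodrigues formula) for every $n\in\mathbb{N}$, $P_n^{(\nu)}(x)=G_n^{(\nu)}\left(\frac{d^nW^{(\nu+n)}}{dx^n}(x)\right)\bigl(W^{(\nu)}(x)\bigr)^{-1}$, where $G_n^{(\nu)}=(K_n^{(\nu)})^{-1}(K_{n-1}^{(\nu+1)})^{-1}\cdots(K_1^{(\nu+n-1)})^{-1}$ (wherever $W^{(\nu)}(x)$ is invertible). Empty products are the identity. *)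

(* Defs.v *)
Set Warnings "-notation-overridden,-notation-incompatible-prefix".
From HB Require Import structures.
From mathcomp Require Export all_boot all_order all_algebra.
From mathcomp Require Export all_classical all_reals all_analysis.
From mathcomp.real_closed Require Export complex.

Set Implicit Arguments.
Unset Strict Implicit.
Unset Printing Implicit Defensive.

Export Order.TTheory GRing.Theory Num.Theory.
Export numFieldNormedType.Exports.

Open Scope classical_set_scope.
Open Scope sesquilinear_scope.
Open Scope complex_scope.
Open Scope ring_scope.

(* Matrices have size N.+1, so that 'M[R[i]]_N.+1 is a (nontrivial) ring and
   {poly 'M[R[i]]_N.+1} is the type of matrix valued polynomials.  The adjoint
   (conjugate transpose) of A is A ^t*. *)

Section MatrixFunctions.
Variables (R : realType) (N : nat).
Implicit Types (F : R -> 'M[R[i]]_N.+1) (p : {poly 'M[R[i]]_N.+1}).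

(* R[i] carries no normed space structure over R in the library: derivatives
   and integrals are taken entrywise, on real and imaginary parts. *)
Definition mxderive1 F (x : R) : 'M[R[i]]_N.+1 :=
  \matrix_(j, k) (derive1 (fun t : R => complex.Re (F t j k)) x
               +i* derive1 (fun t : R => complex.Im (F t j k)) x).

Definition mxderive1n (n : nat) F : R -> 'M[R[i]]_N.+1 := iter n mxderive1 F.

Definition mxintegral (D : set R) F : 'M[R[i]]_N.+1 :=
  \matrix_(j, k) (\int[lebesgue_measure]_(x in D) complex.Re (F x j k)
               +i* \int[lebesgue_measure]_(x in D) complex.Im (F x j k)).

(* To be used on open sets D only. *)
Definition C2_on (D : set R) (g : R -> R) : Prop :=
  forall x, D x -> [/\ derivable g x 1, derivable (derive1 g) x 1
                     & {for x, continuous (derive1n 2 g)}].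

Definition posdefmx (A : 'M[R[i]]_N.+1) : Prop :=
  A \is hermsymmx /\
  forall v : 'rV[R[i]]_N.+1, v != 0 -> 0 < (v *m A *m (v ^t* )) ord0 ord0.

Definition oointerval (a b : \bar R) : set R :=
  [set x | (a < x%:E)%E /\ (x%:E < b)%E].

(* The endpoints a and b may be infinite; they are Lebesgue-null, so that the
   values of W outside the open interval are irrelevant. *)
Record matrix_weight (a b : \bar R) (W : R -> 'M[R[i]]_N.+1) : Prop := {
  weight_herm : forall x, oointerval a b x -> W x \is hermsymmx ;
  weight_posdef :
    {ae lebesgue_measure, forall x : R, oointerval a b x -> posdefmx (W x)} ;
  weight_C2 : forall j k,
    C2_on (oointerval a b) (fun x => complex.Re (W x j k)) /\
    C2_on (oointerval a b) (fun x => complex.Im (W x j k)) ;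
  weight_moments : forall (n : nat) j k,
    lebesgue_measure.-integrable (oointerval a b)
      (fun x : R => (x ^+ n * complex.Re (W x j k))%:E) /\
    lebesgue_measure.-integrable (oointerval a b)
      (fun x : R => (x ^+ n * complex.Im (W x j k))%:E)
}.

Definition mxeval p (x : R) : 'M[R[i]]_N.+1 := p.[(x%:C)%:M].

Definition monic_mvop (a b : \bar R) (W : R -> 'M[R[i]]_N.+1)
    (P : nat -> {poly 'M[R[i]]_N.+1}) : Prop :=
  (forall n, size (P n) = n.+1 /\ P n \is monic) /\
  (forall n m, n <> m ->
    mxintegral (oointerval a b)
      (fun x => mxeval (P n) x * W x * (mxeval (P m) x) ^t* ) = 0).

Definition shift_op (Phi Psi Q : {poly 'M[R[i]]_N.+1}) (x : R) :
    'M[R[i]]_N.+1 :=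
  mxeval (deriv Q) x * (mxeval Phi x) ^t* + mxeval Q x * (mxeval Psi x) ^t*.

(* G_n^(nu) = (K_n^(nu))^-1 (K_(n-1)^(nu+1))^-1 ... (K_1^(nu+n-1))^-1,
   with K nu n standing for K_n^(nu). *)
Definition Gmx (T : pzSemiRingType) (K : T -> nat -> 'M[R[i]]_N.+1)
    (nu : T) (n : nat) : 'M[R[i]]_N.+1 :=
  \prod_(i < n) (K (nu + i%:R) (n - i)%N)^-1.

End MatrixFunctions.

(* Main.v *)
Require Import Defs.
From mathcomp Require Import zify ring.

(** Write S^(nu) for the raising operator Q |-> Q' Phi^* + Q Psi^*, acting on
    matrix polynomials.  Iterating the raising relation shows that applying
    S^(nu+n-1), ..., S^(nu) in turn to P_m^(nu+n) gives the left hand side of the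
    formula ([raisenP]); applied to the constant 1 it gives
    (G_n^(nu))^-1 P_n^(nu) ([raisen1]).

    Morally S^(nu) is the derivative in disguise: (Q S^(nu)) W^(nu) is the
    derivative of Q W^(nu+1), so that the composition of n of them is the n-th
    derivative of Q W^(nu+n), to which the Leibniz rule applies.  With
    Q = P_m^(nu+n), whose derivatives are multiples of P_(m-k)^(nu+n+k) by the
    lowering relation, this is the right hand side.

    The proof establishes this Leibniz rule ([raisen_Leibniz]) purely
    algebraically, by induction on n with Pascal's rule.  Its only analytic input
    is the polynomial identity
      Psi^(nu) Phi^(nu+1) + Phi^(nu) (Phi^(nu+1))' = Phi^(nu) Psi^(nu+1),
    which lets a raising operator pass a product of Phi's
    ([raiseM_phiprod]).  It comes from computing the derivative of W^(nu+2) by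
    means of both Pearson equations ([pearson_compat]).  The weights are
    invertible almost everywhere, hence at infinitely many points of the
    interval, which turns pointwise equalities into equalities of polynomials
    ([mxpoly_eq]); these then hold at every real x, inside the interval or not. *)

(** * Compositions of raising operators *)

Section RaisingOperators.
Set Implicit Arguments.

Variables (A : unitRingType) (phi psi : nat -> {poly A}).
Implicit Types (p q : {poly A}) (i j k n : nat).

(** [raise i] is the operator S^(nu+i) when [phi i] and [psi i] are the adjoints
    of Phi^(nu+i) and Psi^(nu+i). *)
Definition raise i p := p^`() * phi i + p * psi i.

(** Composition of [n] raising operators: the highest level i + n - 1 acts
    first, the lowest level [i] last. *)
Fixpoint raisen i n p := if n is n'.+1 then raise i (raisen i.+1 n' p) else p.

Fixpoint phiprod i k := if k is k'.+1 then phiprod i.+1 k' * phi i else 1.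

(** The recursion of [phiprod] peels off the factor of lowest index, on the
    right; raising a product also brings out the factor of highest index, on
    the left. *)
Lemma phiprodSl i k : phiprod i k.+1 = phi (i + k) * phiprod i k.
Proof.
elim: k i => [|k IHk] i; first by rewrite /= addn0 mul1r mulr1.
by rewrite -[LHS]/(phiprod i.+1 k.+1 * phi i) IHk -mulrA addSnnS.
Qed.

Lemma raiseD i : {morph raise i : p q / p + q}.
Proof. by move=> p q; rewrite /raise derivD !mulrDl addrACA. Qed.

Lemma raise_sum i n (F : 'I_n -> {poly A}) :
  raise i (\sum_j F j) = \sum_j raise i (F j).
Proof.
by apply: (big_morph _ (raiseD i)); rewrite /raise deriv0 !mul0r addr0.
Qed.

Lemma raiseMn i p n : raise i (p *+ n) = raise i p *+ n.
Proof. by rewrite /raise derivMn !mulrnAl mulrnDl. Qed.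

Lemma raiseZ i c p : raise i (c *: p) = c *: raise i p.
Proof. by rewrite /raise derivZ -!scalerAl scalerDr. Qed.

Lemma raiseM i p q : raise i (p * q) = p^`() * q * phi i + p * raise i q.
Proof. by rewrite /raise derivM mulrDl mulrDr !mulrA addrA. Qed.

(** The adjoint of [pearson_compat] below: consistency of the two Pearson
    equations at neighbouring levels. *)
Hypothesis compat : forall i, raise i (phi i.+1) = psi i.+1 * phi i.

(** By induction from [compat], which is the case of a single factor: each
    factor passed turns [psi] into the one of the next level. *)
Lemma raise_phiprod i k : raise i (phiprod i.+1 k) = psi (i + k) * phiprod i k.
Proof.
elim: k => [|k IHk].
  by rewrite /raise derivC mul0r add0r mul1r addn0 mulr1.
rewrite phiprodSl raiseM IHk -mulrA -[phiprod i.+1 k * phi i]/(phiprod i k.+1).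
rewrite phiprodSl !mulrA -mulrDl addSn addnS.
by rewrite -/(raise (i + k) (phi (i + k).+1)) compat -!mulrA -phiprodSl.
Qed.

(** The twisted product rule: in a term of the Leibniz expansion, the operator
    either differentiates the left factor or raises the middle one, at the level
    where the middle factor belongs. *)
Lemma raiseM_phiprod i k p q :
  raise i (p * q * phiprod i.+1 k)
  = p^`() * q * phiprod i k.+1 + p * raise (i + k) q * phiprod i k.
Proof.
rewrite raiseM raise_phiprod derivM -(mulrA _ _ (phi i)).
rewrite -[phiprod i.+1 k * phi i]/(phiprod i k.+1) mulrDl -addrA; congr (_ + _).
by rewrite phiprodSl /raise mulrDr mulrDl !mulrA.
Qed.

(** The Leibniz rule for a composition of raising operators.  It is the
    Leibniz rule for the n-th derivative of Q W, freed of the weight W: by the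
    twisted product rule the k-th term at level i + 1 contributes to the terms
    [k] and [k.+1] at level i, and Pascal's rule collects them. *)
Lemma raisen_Leibniz i n p :
  raisen i n p = \sum_(k < n.+1)
    (p^`(k) * raisen (i + k) (n - k) 1 * phiprod i k) *+ 'C(n, k).
Proof.
elim: n i => [|n IHn] i.
  by rewrite big_ord_recl big_ord0 /= addr0 !mulr1.
pose t k := p^`(k) * raisen (i + k) (n.+1 - k) 1 * phiprod i k.
have step k : (k <= n)%N ->
    raise i (p^`(k) * raisen (i.+1 + k) (n - k) 1 * phiprod i.+1 k)
    = t k.+1 + t k.
  by move=> lekn; rewrite raiseM_phiprod -derivnS /t subSS subSn //= addnS.
rewrite -[RHS]/(\sum_(k < n.+2) t k *+ 'C(n.+1, k)) /= IHn raise_sum.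
under [LHS]eq_bigr => k _ do rewrite raiseMn (step _ (ltn_ord k)) mulrnDl.
move: {step} t => t.
rewrite big_split [RHS]big_ord_recl bin0 mulr1n.
under [in RHS]eq_bigr => k _ do rewrite lift0 binS mulrnDr.
rewrite big_split /= addrC addrA; congr (_ + _).
rewrite [LHS]big_ord_recl /= bin0 mulr1n; congr (_ + _).
by rewrite [RHS]big_ord_recr /= bin_small // mulr0n addr0.
Qed.

Variables (P : nat -> nat -> {poly A}) (K G : nat -> nat -> A).
Hypothesis P0 : forall i, P i 0 = 1.
Hypothesis derivP : forall i n, (P i n)^`() = P i.+1 n.-1 *+ n.
Hypothesis raiseP : forall i n, raise i (P i.+1 n) = K i n.+1 *: P i n.+1.
Hypothesis K_unit : forall i n, K i n.+1 \is a GRing.unit.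
Hypothesis G0 : forall i, G i 0 = 1.
Hypothesis GS : forall i n, G i n.+1 = (K i n.+1)^-1 * G i.+1 n.

Lemma G_unit i n : G i n \is a GRing.unit.
Proof.
elim: n i => [|n IHn] i; first by rewrite G0 unitr1.
by rewrite GS unitrMl ?unitrV ?K_unit ?IHn.
Qed.

(** The constants [K] met while climbing down from level i + n to level i are
    those of [G i (n + m)] that do not occur in [G (i + n) m]. *)
Lemma raisenP i n m :
  raisen i n (P (i + n) m) = (G (i + n) m * (G i (n + m))^-1) *: P i (n + m).
Proof.
elim: n i => [|n IHn] i.
  by rewrite addn0 add0n divrr ?G_unit // scale1r.
rewrite /= -addSnnS IHn raiseZ raiseP scalerA addSn GS.
by rewrite invrM ?unitrV ?K_unit ?G_unit // invrK mulrA.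
Qed.

Lemma raisen1 i n : raisen i n 1 = (G i n)^-1 *: P i n.
Proof. by rewrite -(P0 (i + n)) raisenP G0 addn0 mul1r. Qed.

Lemma derivnP i n k : (P i n)^`(k) = P (i + k) (n - k) *+ n ^_ k.
Proof.
elim: k => [|k IHk]; first by rewrite addn0 subn0.
by rewrite derivnS IHk derivMn derivP addnS subnS -mulrnA mulnC -ffactnSr.
Qed.

(** Raising [P n m] from level n to level 0 in two ways: by [raisenP] in one
    stroke, and by the Leibniz rule, where the derivatives lower [P n m] and the
    shorter compositions produce the polynomials at level k. *)
Lemma addition_formula n m :
  (G n m * (G 0 (n + m))^-1) *: P 0 (m + n)
  = \sum_(k < (minn n m).+1)
      (P (n + k) (m - k) * ((G k (n - k))^-1 *: P k (n - k)) * phiprod 0 k)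
        *+ ('C(n, k) * 'C(m, k) * k`!).
Proof.
rewrite (addnC m) -(raisenP 0 n m) raisen_Leibniz add0n.
pose F k :=
  (P (n + k) (m - k) * ((G k (n - k))^-1 *: P k (n - k)) * phiprod 0 k) *+
     ('C(n, k) * 'C(m, k) * k`!).
rewrite (eq_bigr (fun k : 'I_n.+1 => F k)) => [|k _]; last first.
  rewrite derivnP raisen1 add0n !mulrnAl -mulrnA /F -mulnA bin_ffact.
  by rewrite (mulnC 'C(n, k)).
rewrite -[RHS]/(\sum_(k < (minn n m).+1) F k) -!(big_mkord xpredT F).
(* The terms with m < k <= n vanish together with the binomial 'C(m, k). *)
rewrite [LHS](@big_cat_nat _ _ _ (minn n m).+1) ?ltnS ?geq_minl //=.
rewrite [X in _ + X]big_nat_cond [X in _ + X]big1 ?addr0 //.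
move=> k /andP[/andP[ltk lekn] _].
have ltmk : (m < k)%N by lia.
by rewrite /F (bin_small ltmk) muln0 mul0n mulr0n.
Qed.

End RaisingOperators.

(** * Matrix polynomials, their adjoints and their values on the real line *)

Section MatrixPolynomials.
Set Implicit Arguments.

Variables (R : realType) (N : nat).
Local Notation M := ('M[R[i]]_N.+1).
Implicit Types (p q : {poly M}) (A B : M) (x : R).

Lemma scalar_comm (c : R[i]) (A : M) : GRing.comm A c%:M.
Proof. exact: comm_mx_scalar. Qed.

Lemma mxevalM p q x : mxeval (p * q) x = mxeval p x * mxeval q x.
Proof. by rewrite /mxeval hornerM_comm //; exact/commr_sym/scalar_comm. Qed.

Lemma mxevalD p q x : mxeval (p + q) x = mxeval p x + mxeval q x.
Proof. exact: hornerD. Qed.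

Lemma mxevalZ A p x : mxeval (A *: p) x = A * mxeval p x.
Proof. exact: hornerZ. Qed.

Lemma mxevalMn p n x : mxeval (p *+ n) x = mxeval p x *+ n.
Proof. exact: hornerMn. Qed.

Lemma mxeval_sum n (F : 'I_n -> {poly M}) x :
  mxeval (\sum_l F l) x = \sum_l mxeval (F l) x.
Proof. exact: horner_sum. Qed.

Definition adjpoly p : {poly M} := map_poly (fun A : M => A ^t* ) p.

Lemma trmxC0 : (0 : M) ^t* = 0.
Proof. by rewrite trmx0 map_mx0. Qed.

Lemma trmxCD A B : (A + B) ^t* = A ^t* + B ^t*.
Proof. by rewrite linearD /= map_mxD. Qed.

Lemma trmxCM A B : (A * B) ^t* = B ^t* * A ^t*.
Proof. by rewrite [A * B]/(A *m B) trmx_mul map_mxM. Qed.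

Lemma trmxCMn A n : (A *+ n) ^t* = A ^t* *+ n.
Proof. by elim: n => [|n IHn]; rewrite ?trmxC0 // !mulrS trmxCD IHn. Qed.

Lemma coef_adjpoly p k : (adjpoly p)`_k = (p`_k) ^t*.
Proof. by rewrite coef_map_id0 // trmxC0. Qed.

Lemma mxeval_adjpoly p x : mxeval (adjpoly p) x = (mxeval p x) ^t*.
Proof.
elim/poly_ind: p => [|p c IHp].
  by rewrite /mxeval /adjpoly map_poly0 !horner0 trmxC0.
have -> : adjpoly (p * 'X + c%:P) = adjpoly p * 'X + (c ^t* )%:P.
  apply/polyP => k.
  rewrite coefD coef_adjpoly coefD !coefMX !coefC coef_adjpoly.
  by case: k => [|k]; rewrite trmxCD ?trmxC0.
rewrite /mxeval !hornerMXaddC trmxCD trmxCM -/(mxeval _ x) -/(mxeval p x) IHp.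
rewrite [X in _ = X + _](_ : _ = (mxeval p x) ^t* * (x%:C)%:M) //.
rewrite scalar_comm; congr (_ * _).
rewrite tr_scalar_mx map_scalar_mx /=; congr (_%:M); apply/eqP.
by rewrite eq_complex /= oppr0 !eqxx.
Qed.

Lemma deriv_adjpoly p : (adjpoly p)^`() = adjpoly p^`().
Proof.
by apply/polyP => k; rewrite coef_deriv !coef_adjpoly coef_deriv trmxCMn.
Qed.

Lemma adjpolyD p q : adjpoly (p + q) = adjpoly p + adjpoly q.
Proof. by apply/polyP => k; rewrite !(coefD, coef_adjpoly) trmxCD. Qed.

Lemma trmxC_sum n (F : 'I_n -> M) : (\sum_l F l) ^t* = \sum_l (F l) ^t*.
Proof. exact: (big_morph (fun A : M => A ^t* ) trmxCD trmxC0). Qed.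

Lemma adjpolyM p q : adjpoly (p * q) = adjpoly q * adjpoly p.
Proof.
apply/polyP => k; rewrite coef_adjpoly coefMr coefM trmxC_sum.
by apply: eq_bigr => l _; rewrite trmxCM !coef_adjpoly.
Qed.

Definition mxpoly_entry p j k : {poly R[i]} :=
  \poly_(l < size p) (p`_l j k).

Lemma horner_entry p j k x : (mxpoly_entry p j k).[x%:C] = mxeval p x j k.
Proof.
rewrite horner_poly /mxeval horner_coef summxE; apply: eq_bigr => l _.
have -> : ((x%:C)%:M : M) ^+ l = (x%:C ^+ l)%:M by rewrite rmorphXn.
by rewrite -[X in _ = fun_of_matrix X _ _]/(_ *m _) mul_mx_scalar mxE mulrC.
Qed.

(** If p <> q, some entry of p - q is a nonzero scalar polynomial; [D] contains
    a point that avoids the real parts of its finitely many roots. *)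
Lemma mxpoly_eq (D : set R) p q :
  (forall s : seq R, exists2 x, D x & x \notin s) ->
  (forall x, D x -> mxeval p x = mxeval q x) -> p = q.
Proof.
move=> Dinf pq; apply/eqP; rewrite -subr_eq0; apply/eqP/polyP => l.
rewrite coef0; apply/matrixP => j k; rewrite mxE.
pose e := mxpoly_entry (p - q) j k.
suff e0 : e = 0.
  have : e`_l = 0 by rewrite e0 coef0.
  rewrite coef_poly; case: ltnP => // /(nth_default 0) -> _.
  by rewrite mxE.
apply/eqP; apply: contraT => nz_e.
have [s es] := closed_field_poly_normal e.
have [x Dx xs] := Dinf (map (@complex.Re R) s).
have : e.[x%:C] = 0.
  rewrite horner_entry /mxeval hornerD hornerN -/(mxeval p x) pq //.
  by rewrite subrr mxE.
rewrite es hornerZ => /eqP; rewrite mulf_eq0 lead_coef_eq0 (negbTE nz_e) /=.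
rewrite -rootE root_prod_XsubC => /(map_f (@complex.Re R)) /= xs'.
by rewrite xs' in xs.
Qed.

(** The point chosen exceeds the absolute values of all entries of [s]. *)
Lemma setT_infinite (s : seq R) : exists2 x, setT x & x \notin s.
Proof.
pose y := \sum_(z <- s) `|z| + 1.
exists y => //; apply/negP => ys.
have : `|y| <= \sum_(z <- s) `|z|.
  by rewrite (big_rem y) //= lerDl sumr_ge0.
have y0 : 0 <= y by rewrite addr_ge0 ?sumr_ge0.
by rewrite ger0_norm // /y gerDl ler10.
Qed.

End MatrixPolynomials.

(** * Derivatives of matrix functions *)

Section MatrixDerivatives.
Set Implicit Arguments.

Variables (R : realType) (N : nat).
Local Notation M := ('M[R[i]]_N.+1).
Implicit Types (p : {poly M}) (F G W : R -> M) (A B : M) (x : R).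

(** [mxderive1] is a total operator whose value means little where the entries
    are not derivable; this relation also records derivability. *)
Definition is_mxderive F x A : Prop := forall j k,
  is_derive x 1 (fun t => complex.Re (F t j k)) (complex.Re (A j k)) /\
  is_derive x 1 (fun t => complex.Im (F t j k)) (complex.Im (A j k)).

Lemma is_mxderive_eq F x A : is_mxderive F x A -> mxderive1 F x = A.
Proof.
move=> FA; apply/matrixP => j k; rewrite mxE !derive1E.
have [reF imF] := FA j k.
by rewrite !derive_val; case: (A j k).
Qed.

Lemma ReD (z w : R[i]) : complex.Re (z + w) = complex.Re z + complex.Re w.
Proof. by case: z w => [? ?] []. Qed.

Lemma ImD (z w : R[i]) : complex.Im (z + w) = complex.Im z + complex.Im w.
Proof. by case: z w => [? ?] []. Qed.

Lemma Re_sum n (f : 'I_n -> R[i]) :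
  complex.Re (\sum_l f l) = \sum_l complex.Re (f l).
Proof. by apply: (big_morph _ ReD). Qed.

Lemma Im_sum n (f : 'I_n -> R[i]) :
  complex.Im (\sum_l f l) = \sum_l complex.Im (f l).
Proof. by apply: (big_morph _ ImD). Qed.

Lemma ReM (z w : R[i]) : complex.Re (z * w) =
  complex.Re z * complex.Re w - complex.Im z * complex.Im w.
Proof. by case: z w => [? ?] []. Qed.

Lemma ImM (z w : R[i]) : complex.Im (z * w) =
  complex.Re z * complex.Im w + complex.Im z * complex.Re w.
Proof. by case: z w => [? ?] []. Qed.

Lemma is_mxderive_cst A x : is_mxderive (fun=> A) x 0.
Proof. by move=> j k; rewrite mxE; split; exact: is_derive_cst. Qed.

Lemma is_mxderive_id x : is_mxderive (fun t => (t%:C)%:M) x 1.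
Proof.
move=> j k; split; under eq_fun do rewrite mxE; rewrite mxE.
  case: (j == k); rewrite /= ?mulr1n ?mulr0n; last exact: is_derive_cst.
  exact: is_derive_id.
by case: (j == k); exact: is_derive_cst.
Qed.

Lemma is_mxderiveD F G x A B : is_mxderive F x A -> is_mxderive G x B ->
  is_mxderive (fun t => F t + G t) x (A + B).
Proof.
move=> FA GB j k; have [? ?] := FA j k; have [? ?] := GB j k.
by split; under eq_fun do rewrite mxE ?ReD ?ImD; rewrite mxE ?ReD ?ImD;
  exact: is_deriveD.
Qed.

Lemma is_mxderiveM F G x A B : is_mxderive F x A -> is_mxderive G x B ->
  is_mxderive (fun t => F t * G t) x (A * G x + F x * B).
Proof.
move=> FA GB j k.
split.
- under eq_fun do rewrite mxE Re_sum.
  rewrite !mxE -big_split Re_sum /=.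
  under [X in is_derive _ _ X _]funext => t do under eq_bigr do rewrite ReM.
  rewrite -fct_sumE.
  apply: is_derive_sum => l; have [? ?] := FA j l; have [? ?] := GB l k.
  apply: is_derive_eq; rewrite ReD !ReM /GRing.scale /=; ring.
- under eq_fun do rewrite mxE Im_sum.
  rewrite !mxE -big_split Im_sum /=.
  under [X in is_derive _ _ X _]funext => t do under eq_bigr do rewrite ImM.
  rewrite -fct_sumE.
  apply: is_derive_sum => l; have [? ?] := FA j l; have [? ?] := GB l k.
  apply: is_derive_eq; rewrite ImD !ImM /GRing.scale /=; ring.
Qed.

Lemma near_is_mxderive F G x A : (\near x, F x = G x) ->
  is_mxderive F x A -> is_mxderive G x A.
Proof.
move=> FG FA j k; have [? ?] := FA j k.
by split; [apply: (@near_eq_is_derive _ _ _ (fun t => complex.Re (F t j k))) |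
  apply: (@near_eq_is_derive _ _ _ (fun t => complex.Im (F t j k)))] => //;
  apply: filterS FG => t ->.
Qed.

Lemma is_mxderive_mxeval p x : is_mxderive (mxeval p) x (mxeval p^`() x).
Proof.
elim/poly_ind: p => [|p c IHp].
  rewrite deriv0 /mxeval horner0; under eq_fun do rewrite horner0.
  exact: is_mxderive_cst.
have -> : mxeval (p * 'X + c%:P) = fun t => mxeval p t * (t%:C)%:M + c.
  by apply/funext => t; rewrite /mxeval hornerMXaddC.
have -> : mxeval (p * 'X + c%:P)^`() x
          = (mxeval p^`() x * (x%:C)%:M + mxeval p x * 1) + 0.
  by rewrite derivMXaddC /mxeval hornerD hornerMX mulr1 addr0 addrC.
apply: is_mxderiveD; last exact: is_mxderive_cst.
exact: is_mxderiveM IHp (is_mxderive_id x).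
Qed.

Lemma matrix_weight_is_mxderive (a b : \bar R) W x :
  matrix_weight a b W -> oointerval a b x -> is_mxderive W x (mxderive1 W x).
Proof.
move=> wW abx j k; rewrite mxE /= !derive1E.
have [/(_ x abx)[dRe _ _] /(_ x abx)[dIm _ _]] := weight_C2 wW j k.
by split; exact: DeriveDef.
Qed.

End MatrixDerivatives.

(** * Consistency of the Pearson equations *)

Section PearsonEquations.
Set Implicit Arguments.

Variables (R : realType) (N : nat).
Local Notation M := ('M[R[i]]_N.+1).

Lemma oointerval_sub (a b : \bar R) : (a < b)%E ->
  exists c d : R, c < d /\ `]c, d[%classic `<=` oointerval a b.
Proof.
case: a b => [a||] [b||] //= ab.
- exists a, b; split; first by rewrite -lte_fin.
  by move=> x /=; rewrite in_itv /= => /andP[? ?]; split; rewrite lte_fin.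
- exists a, (a + 1); split; first by rewrite ltrDl.
  move=> x /=; rewrite in_itv /= => /andP[? ?].
  by split; rewrite ?lte_fin ?ltry.
- exists (b - 1), b; split; first by rewrite gtrBl.
  move=> x /=; rewrite in_itv /= => /andP[? ?].
  by split; rewrite ?lte_fin ?ltNyr.
- exists 0, 1; split; first by [].
  by move=> x _; split; rewrite ?ltry ?ltNyr.
Qed.

(** An open interval of positive length is not covered by a null set together
    with a finite set. *)
Lemma ae_oointerval_infinite (a b : \bar R) (Q : R -> Prop) (s : seq R) :
  (a < b)%E -> {ae lebesgue_measure, forall x : R, oointerval a b x -> Q x} ->
  exists2 x, (oointerval a b `&` Q) x & x \notin s.
Proof.
move=> /oointerval_sub[c [d [cd cdab]]] aeQ; apply: contrapT => noQ.
have: lebesgue_measure.-negligible (`]c, d[%classic : set R).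
  have bad : (lebesgue_measure : {measure set _ -> \bar R}).-negligible
      (~` [set x : R | oointerval a b x -> Q x] `|` [set` s]).
    apply: negligibleU => //; apply/negligibleP.
      exact/countable_measurable/finite_set_countable/finite_seq.
    exact/countable_lebesgue_measure0/finite_set_countable/finite_seq.
  apply: negligibleS bad => x cdx.
  case: (boolP (x \in s)) => xs; first by right.
  by left => xQ; apply: noQ; exists x => //; split; [|apply: xQ]; exact: cdab.
move/measure_negligible => /(_ (measurable_itv _)) null.
have := lebesgue_measure_itv `]c, d[.
rewrite /= lte_fin cd {}null => /esym/eqP.
by rewrite -EFinB eqe subr_eq0 gt_eqF.
Qed.

Lemma oointerval_open (a b : \bar R) : open (oointerval a b).
Proof.
by apply: openI; [exact: open_ereal_gt | exact: open_ereal_lt].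
Qed.

(** A vector of the left kernel of A would have v A v^* = 0. *)
Lemma posdefmx_unit (A : M) : posdefmx A -> A \is a GRing.unit.
Proof.
case=> _ Apos; rewrite -[_ \is a _]/(A \in unitmx) -row_free_unit -kermx_eq0.
apply/eqP/row_matrixP => l; rewrite row0; apply/eqP; apply: contraT => /Apos.
have -> : row l (kermx A) *m A = 0 by apply/sub_kermxP; exact: row_sub.
by rewrite mul0mx mxE ltxx.
Qed.

(** Both sides, multiplied by W0 on the left, are the derivative of W2: the
    right hand side by the derivative equation for W2, the left hand side by
    the product rule for W2 = W1 * Phi1. As W0 is invertible almost
    everywhere, the polynomials agree at infinitely many points. *)
Lemma pearson_compat (a b : \bar R) (W0 W1 W2 : R -> M)
    (Phi0 Phi1 Psi0 Psi1 : {poly M}) :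
  (a < b)%E -> matrix_weight a b W0 -> matrix_weight a b W1 ->
  (forall x, oointerval a b x -> W1 x = W0 x * mxeval Phi0 x) ->
  (forall x, oointerval a b x -> W2 x = W1 x * mxeval Phi1 x) ->
  (forall x, oointerval a b x -> mxderive1 W1 x = W0 x * mxeval Psi0 x) ->
  (forall x, oointerval a b x -> mxderive1 W2 x = W1 x * mxeval Psi1 x) ->
  Psi0 * Phi1 + Phi0 * Phi1^`() = Phi0 * Psi1.
Proof.
move=> ltab wW0 wW1 W1E W2E dW1E dW2E.
pose D := oointerval a b `&` (fun x => posdefmx (W0 x)).
apply: (@mxpoly_eq _ _ D) => [s|x [abx posW]].
  exact: ae_oointerval_infinite ltab (weight_posdef wW0).
rewrite mxevalD !mxevalM; apply: (mulrI (posdefmx_unit posW)).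
rewrite [RHS]mulrA -W1E // -dW2E // mulrDr !mulrA -dW1E // -W1E //.
apply/esym/is_mxderive_eq.
have dW1 := matrix_weight_is_mxderive wW1 abx.
apply: near_is_mxderive (is_mxderiveM dW1 (is_mxderive_mxeval Phi1 x)).
have nbx : nbhs x (oointerval a b).
  by apply: open_nbhs_nbhs; split => //; exact: oointerval_open.
by apply: filterS nbx => t abt; rewrite W2E.
Qed.

End PearsonEquations.

(** * The addition formula *)

Section NormalizingConstants.
Variables (R : realType) (N : nat) (T : pzSemiRingType).
Variable K : T -> nat -> 'M[R[i]]_N.+1.

Lemma Gmx0 nu : Gmx K nu 0 = 1.
Proof. exact: big_ord0. Qed.

Lemma GmxS nu n : Gmx K nu n.+1 = (K nu n.+1)^-1 * Gmx K (nu + 1) n.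
Proof.
rewrite /Gmx big_ord_recl addr0 subn0; congr (_ * _); apply: eq_bigr => l _.
by rewrite lift0 subSS -addrA -mulrS.
Qed.

End NormalizingConstants.

Theorem corollary4p2 (R : realType) (N : nat) (T : pzSemiRingType) (V : set T)
  (a b : \bar R)
  (W : T -> R -> 'M[R[i]]_N.+1)
  (P : T -> nat -> {poly 'M[R[i]]_N.+1})
  (Phi Psi : T -> {poly 'M[R[i]]_N.+1})
  (K : T -> nat -> 'M[R[i]]_N.+1)
  (ltab : (a < b)%E)
  (V_shift : forall nu, V nu -> V (nu + 1))
  (W_weight : forall nu, V nu -> matrix_weight a b (W nu))
  (P_mvop : forall nu, V nu -> monic_mvop a b (W nu) (P nu))
  (size_Phi : forall nu, V nu -> (size (Phi nu) <= 3)%N)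
  (size_Psi : forall nu, V nu -> (size (Psi nu) <= 2)%N)
  (Pearson_Phi : forall nu x, V nu -> oointerval a b x ->
    W (nu + 1) x = W nu x * mxeval (Phi nu) x)
  (Pearson_Psi : forall nu x, V nu -> oointerval a b x ->
    mxderive1 (W (nu + 1)) x = W nu x * mxeval (Psi nu) x)
  (lowering : forall nu n, V nu -> (1 <= n)%N ->
    deriv (P nu n) = P (nu + 1) n.-1 *+ n)
  (K_unit : forall nu n, V nu -> (1 <= n)%N -> K nu n \is a GRing.unit)
  (raising : forall nu n (x : R), V nu -> (1 <= n)%N ->
    shift_op (Phi nu) (Psi nu) (P (nu + 1) n.-1) x
    = K nu n * mxeval (P nu n) x)
  (Rodrigues : forall nu n x, V nu -> oointerval a b x ->
    W nu x \is a GRing.unit ->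
    mxeval (P nu n) x
    = Gmx K nu n * mxderive1n n (W (nu + n%:R)) x * (W nu x)^-1)
  (nu : T) (n m : nat) (x : R) :
  V nu ->
  Gmx K (nu + n%:R) m * (Gmx K nu (n + m))^-1 * mxeval (P nu (m + n)%N) x
  = \sum_(k < (minn n m).+1)
      ('C(n, k) * 'C(m, k) * k`!)%:R *:
      (mxeval (P (nu + n%:R + k%:R) (m - k)%N) x
       * (Gmx K (nu + k%:R) (n - k))^-1
       * mxeval (P (nu + k%:R) (n - k)%N) x
       * (\prod_(i < k) mxeval (Phi (nu + i%:R)) x) ^t* ).
Proof.
move=> Vnu.
have VS j : V (nu + j%:R).
  by elim: j => [|j IHj]; rewrite ?addr0 // mulrSr addrA; exact: V_shift.
have nuS j : nu + j.+1%:R = nu + j%:R + 1 by rewrite mulrSr addrA.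
pose phi j := adjpoly (Phi (nu + j%:R)).
pose psi j := adjpoly (Psi (nu + j%:R)).
pose Q j l := P (nu + j%:R) l.
have compat j : raise phi psi j (phi j.+1) = psi j.+1 * phi j.
  have := @pearson_compat _ _ _ _ _ _ _ _ _ _ _ ltab
    (W_weight _ (VS j)) (W_weight _ (V_shift _ (VS j)))
    (fun y => Pearson_Phi _ y (VS j))
    (fun y => Pearson_Phi _ y (V_shift _ (VS j)))
    (fun y => Pearson_Psi _ y (VS j))
    (fun y => Pearson_Psi _ y (V_shift _ (VS j))).
  rewrite /raise /phi /psi nuS deriv_adjpoly => /(congr1 (@adjpoly _ _)).
  by rewrite adjpolyD !adjpolyM addrC.
have Q0 j : Q j 0 = 1.
  have [+ /monicP] := (P_mvop _ (VS j)).1 0.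
  rewrite /Q /lead_coef => sz1; rewrite sz1 => lc.
  by rewrite [LHS]size1_polyC ?sz1 //= lc.
have derivQ j l : (Q j l)^`() = Q j.+1 l.-1 *+ l.
  case: l => [|l]; first by rewrite Q0 derivC mulr0n.
  by rewrite /Q nuS lowering.
have raiseQ j l : raise phi psi j (Q j.+1 l) = K (nu + j%:R) l.+1 *: Q j l.+1.
  apply: (@mxpoly_eq _ _ setT) => [s|y _]; first exact: setT_infinite.
  rewrite mxevalZ -(raising _ _ _ (VS j)) // mxevalD !mxevalM !mxeval_adjpoly.
  by rewrite /Q nuS.
have K_unitS j l : K (nu + j%:R) l.+1 \is a GRing.unit by apply: K_unit.
pose G j l := Gmx K (nu + j%:R) l.
have G0 j : G j 0 = 1 by exact: Gmx0.
have GS j l : G j l.+1 = (K (nu + j%:R) l.+1)^-1 * G j.+1 l.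
  by rewrite /G nuS; exact: GmxS.
have := @addition_formula _ phi psi compat Q (fun j => K (nu + j%:R)) G
  Q0 derivQ raiseQ K_unitS G0 GS n m.
move/(congr1 (fun p => mxeval p x)); rewrite mxevalZ /Q /G addr0 => ->.
have phiprodE k : mxeval (phiprod phi 0 k) x
    = (\prod_(l < k) mxeval (Phi (nu + l%:R)) x) ^t*.
  elim: k => [|k IHk].
    by rewrite big_ord0 /mxeval hornerC -[1]/(1%:M) tr_scalar_mx map_mx1.
  by rewrite phiprodSl mxevalM IHk add0n mxeval_adjpoly big_ord_recr trmxCM.
rewrite mxeval_sum; apply: eq_bigr => k _.
rewrite mxevalMn !mxevalM mxevalZ phiprodE natrD addrA scaler_nat.
by rewrite !mulrA.
Qed.
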